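(* For real $b$ and nonnegative integers $n$ let $$H_n(b,x)=\det\left(\binom{x+i+j}{2j}+b\binom{x+i+j}{2j+1}\right)_{i,j=0}^{n-1}$$ (a polynomial in $x$, $H_0(b,x)=1$). Then for every $n\ge0$, $$V_n(b,x):=2^nH_n\left(b,\frac{2x-1}{2}\right)=\det\left(\binom{x+i+j}{2j}\frac{2x+2i}{x+i+j}+b\binom{x+i+j}{2j+1}\frac{2x+2i-1}{x+i+j}\right)_{i,j=0}^{n-1},$$ where each matrix entry is understood as the polynomial in $x$ obtained after cancelling the factor $x+i+j$ (for $j=0$ the entry is $2+b(2x+2i-1)$).
   Context: For a polynomial variable $y$ and integer $m\ge0$, $\binom{y}{m}=\frac{y(y-1)\cdots(y-m+1)}{m!}$. The determinant of a $0\times0$ matrix is $1$. *)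

(* Defs.v *)
From mathcomp Require Import all_boot all_order all_algebra.
From mathcomp Require Import reals.

Set Implicit Arguments.
Unset Strict Implicit.
Unset Printing Implicit Defensive.

Import GRing.Theory Num.Theory.
Local Open Scope ring_scope.

Definition binomp (R : realType) (y : {poly R}) (m : nat) : {poly R} :=
  (m`!%:R : R)^-1 *: \prod_(k < m) (y - k%:R).

Definition H (R : realType) (n : nat) (b : R) : {poly R} :=
  \det (\matrix_(i < n, j < n)
    (binomp ('X + i%:R + j%:R) (2 * j)%N +
     b *: binomp ('X + i%:R + j%:R) (2 * j + 1)%N)).

Definition V (R : realType) (n : nat) (b : R) : {poly R} :=
  2 ^+ n * (H n b \Po (2^-1 *: (2 * 'X - 1))).

(* The two fractions of an entry: %/ is Euclidean division in {poly R}; it is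
   exact here, see Vnum_even_dvd and Vnum_odd_dvd. *)
Definition Vnum_even (R : realType) (i j : nat) : {poly R} :=
  binomp ('X + i%:R + j%:R) (2 * j)%N * (2 * 'X + 2 * i%:R).

Definition Vnum_odd (R : realType) (i j : nat) : {poly R} :=
  binomp ('X + i%:R + j%:R) (2 * j + 1)%N * (2 * 'X + 2 * i%:R - 1).

Definition Ventry (R : realType) (b : R) (i j : nat) : {poly R} :=
  Vnum_even R i j %/ ('X + i%:R + j%:R) +
  b *: (Vnum_odd R i j %/ ('X + i%:R + j%:R)).

Lemma H0 (R : realType) (b : R) : H 0 b = 1.
Proof. by rewrite /H det_mx00. Qed.

Lemma dvdp_binomp (R : realType) (y : {poly R}) m : y %| binomp y m.+1.
Proof.
rewrite /binomp big_ord_recl subr0 -mul_polyC mulrCA.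
exact: dvdp_mulIl.
Qed.

Lemma Vnum_even_dvd (R : realType) i j : ('X + i%:R + j%:R : {poly R}) %| Vnum_even R i j.
Proof.
rewrite /Vnum_even; case: j => [|j].
  by rewrite addr0 -mulrDr; apply/dvdp_mull/dvdp_mull.
by rewrite mulnS; apply/dvdp_mulr/dvdp_binomp.
Qed.

Lemma Vnum_odd_dvd (R : realType) i j : ('X + i%:R + j%:R : {poly R}) %| Vnum_odd R i j.
Proof. by rewrite /Vnum_odd addn1; apply/dvdp_mulr/dvdp_binomp. Qed.

Lemma Ventry0 (R : realType) (b : R) i : Ventry b i 0 = 2 + b *: (2 * 'X + 2 * i%:R - 1).
Proof.
have nz : 'X + i%:R != 0 :> {poly R}.
  by rewrite -polyC_natr -[i%:R]opprK polyCN polyXsubC_eq0.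
rewrite /Ventry /Vnum_even /Vnum_odd /binomp !addr0 !muln0 add0n.
rewrite big_ord0 big_ord1 fact0 factS fact0 muln1 invr1 !scale1r mul1r subr0.
by rewrite -mulrDr mulpK // mulrC mulpK.
Qed.

(* Main.v *)
Require Import Defs.
From HB Require Import structures.
From mathcomp Require Import all_boot all_algebra.
From mathcomp Require Import reals ring.

Set Implicit Arguments.
Unset Strict Implicit.
Unset Printing Implicit Defensive.

Import GRing.Theory Num.Theory.
Local Open Scope ring_scope.

(** Put [h_j(x) = C(x+j, 2j) + b C(x+j, 2j+1)], so that [H_n] is the
    determinant of the [h_j(x+i)], and let [T f(x) = f(x+1/2) + f(x-1/2)].  The
    entries of the right-hand determinant are [T h_j] evaluated at [x+i-1/2].
    Now [T^2 = 4 + delta^2] for the central difference [delta], and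
    [delta^2 h_j = h_{j-1}], so [T^2] acts on the [h_j] by a triangular matrix
    with diagonal entries [4].  As [T + 2] is injective, [T] acts by the square
    root of that matrix with diagonal entries [2], and this has determinant
    [2^n]. *)

Lemma trig_mx_sqrt (R : comUnitRingType) (a : R) n (A : 'M[R]_n) :
    2 * a \is a GRing.unit -> is_trig_mx A -> (forall i, A i i = a ^+ 2) ->
  exists C : 'M[R]_n, [/\ is_trig_mx C, forall i, C i i = a & C *m C = A].
Proof.
move=> unit2a; elim/trigsqmx_ind => {n A} [_ | n x u A _ sqrtA diagA].
  by exists 0; split=> [|[]//|]; [apply: mx0_is_trig | rewrite mul0mx].
have [i|C [trigC diagC sqrC]] := sqrtA.
  by have := diagA (rshift 1%N i); rewrite block_mxEdr.
have unitCa : C + a%:M \in unitmx.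
  have trigCa : is_trig_mx (C + a%:M).
    apply/is_trig_mxP=> i j ltij; rewrite !mxE (is_trig_mxP trigC) //.
    by rewrite -val_eqE ltn_eqF // addr0.
  rewrite unitmxE det_trig //; apply: rpred_prod => i _.
  by rewrite !mxE eqxx diagC -mulr2n -mulr_natl.
have xE : x = (a ^+ 2)%:M.
  have := diagA (lshift n ord0); rewrite block_mxEul => x00.
  by rewrite [x]mx11_scalar x00.
(* The lower left block [v] of the root has to satisfy [(C + a) v = u]. *)
exists (block_mx a%:M 0 (invmx (C + a%:M) *m u) C); split.
- by rewrite is_trig_block_mx // eqxx mx11_is_trig.
- move=> i; case: (split_ordP i) => k ->; rewrite ?block_mxEul ?block_mxEdr //.
  by rewrite mxE eqxx.
rewrite mulmx_block sqrC !mul0mx !mulmx0 !addr0 add0r -scalar_mxM -expr2 -xE.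
by rewrite mul_mx_scalar -mul_scalar_mx -mulmxDl addrC mulKVmx.
Qed.

(* The error [e_i = T h_i - \sum_j C_ij h_j] satisfies
   [T e_i = - \sum_j C_ij e_j], which reads [T e_i = - C_ii e_i] once the
   earlier errors are known to vanish. *)
Lemma linear_sqrt_trig (R : comPzRingType) (V : lmodType R)
    (T : {linear V -> V}) n (C : 'M[R]_n) (h : 'I_n -> V) :
    is_trig_mx C -> (forall i v, T v + C i i *: v = 0 -> v = 0) ->
    (forall i, T (T (h i)) = \sum_j (C *m C) i j *: h j) ->
  forall i, T (h i) = \sum_j C i j *: h j.
Proof.
move=> /is_trig_mxP trigC TDC_eq0 sqrT.
pose e i := T (h i) - \sum_j C i j *: h j.
have Te i : T (e i) + \sum_j C i j *: e j = 0.
  have sqrCh : \sum_j (C *m C) i j *: h j = \sum_j C i j *: \sum_k C j k *: h k.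
    under [RHS]eq_bigr do rewrite scaler_sumr.
    rewrite exchange_big; apply: eq_bigr => k _; rewrite mxE scaler_suml.
    by apply: eq_bigr => j _; rewrite scalerA.
  rewrite linearB linear_sum sqrT sqrCh /= -sumrB -big_split big1 // => j _.
  by rewrite /= linearZ scalerBr addrA subrK subrr.
suff e0 i : e i = 0 by move=> i; apply: subr0_eq (e0 i).
have [m] := ubnP (i : nat); elim: m i => // m IHm i; rewrite ltnS => leim.
apply: TDC_eq0; rewrite -[RHS](Te i) [in RHS](bigD1 i) //= big1 ?addr0 // => j.
rewrite neq_ltn => /orP[ltji|/trigC->]; last by rewrite scale0r.
by rewrite IHm ?scaler0 // (leq_trans ltji).
Qed.

Definition poly_shift (R : nzRingType) (c : R) (f : {poly R}) : {poly R} :=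
  f \Po ('X + c%:P).

HB.instance Definition _ (R : comNzRingType) (c : R) :=
  GRing.Linear.copy (poly_shift c) (comp_poly ('X + c%:P)).

Lemma poly_shift0 (R : nzRingType) (f : {poly R}) : poly_shift 0 f = f.
Proof. by rewrite /poly_shift addr0 comp_polyXr. Qed.

Lemma poly_shiftD (R : comNzRingType) (c d : R) (f : {poly R}) :
  poly_shift c (poly_shift d f) = poly_shift (c + d) f.
Proof.
rewrite /poly_shift -comp_polyA comp_polyD comp_polyX comp_polyC.
by rewrite polyCD addrA.
Qed.

Lemma size_poly_shift (R : idomainType) (c : R) (f : {poly R}) :
  size (poly_shift c f) = size f.
Proof. by rewrite size_comp_poly2 ?size_XaddC. Qed.

Lemma lead_coef_poly_shift (R : idomainType) (c : R) (f : {poly R}) :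
  lead_coef (poly_shift c f) = lead_coef f.
Proof.
by rewrite lead_coef_comp ?size_XaddC // lead_coefXaddC expr1n mulr1.
Qed.

Section HalfShiftSum.
Variable R : numFieldType.
Implicit Types f : {poly R}.

Definition half_shift_sum f : {poly R} :=
  poly_shift 2^-1 f + poly_shift (- 2^-1) f.

Lemma half_shift_sum_is_linear : linear half_shift_sum.
Proof. by move=> a f g; rewrite /half_shift_sum !linearP scalerDr addrACA. Qed.

HB.instance Definition _ := GRing.isLinear.Build R {poly R} {poly R} _
  half_shift_sum half_shift_sum_is_linear.

Lemma half_shift_sum_sqr f :
  half_shift_sum (half_shift_sum f) =
    poly_shift 1 f + poly_shift (-1) f + 2 *: f.
Proof.
have halfD : 2^-1 + 2^-1 = 1 :> R by field.
rewrite /half_shift_sum !linearD /= !poly_shiftD subrr addNr poly_shift0.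
by rewrite -opprD halfD scaler_nat mulr2n [f + _]addrC addrACA.
Qed.

Lemma half_shift_sum_addZ_eq0 c f :
  2 + c != 0 -> half_shift_sum f + c *: f = 0 -> f = 0.
Proof.
move=> c_neqN2 /(congr1 (fun g : {poly R} => g`_(size f).-1)).
have shift_lead d : (poly_shift d f)`_(size f).-1 = lead_coef f.
  by rewrite -(size_poly_shift d f) -lead_coefE lead_coef_poly_shift.
rewrite !coefD coefZ !shift_lead -lead_coefE coef0 => /eqP.
rewrite -mulr2n -mulr_natl -mulrDl mulf_eq0 (negPf c_neqN2) lead_coef_eq0.
by move/eqP.
Qed.

End HalfShiftSum.

Section BinomialPolynomial.
Variable R : realType.
Implicit Types y q : {poly R}.

Lemma binomp_comp y q m : binomp y m \Po q = binomp (y \Po q) m.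
Proof.
rewrite /binomp comp_polyZ rmorph_prod; congr (_ *: _); apply: eq_bigr => k _.
by rewrite rmorphB rmorph_nat.
Qed.

Lemma binomp0 y : binomp y 0 = 1.
Proof. by rewrite /binomp big_ord0 fact0 invr1 scale1r. Qed.

Lemma binomp1 y : binomp y 1 = y.
Proof. by rewrite /binomp big_ord1 invr1 scale1r subr0. Qed.

Lemma mul_binomp_down y m : y * binomp (y - 1) m = (y - m%:R) * binomp y m.
Proof.
rewrite /binomp -!scalerAr; congr (_ *: _); rewrite [RHS]mulrC.
transitivity (\prod_(k < m.+1) (y - k%:R)); last by rewrite big_ord_recr.
rewrite big_ord_recl subr0; congr (_ * _); apply: eq_bigr => k _.
by rewrite /= -addrA -opprD nat1r.
Qed.

Lemma mul_binomp_left y m : m.+1%:R * binomp y m.+1 = (y - m%:R) * binomp y m.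
Proof.
have factV : m.+1%:R * (m.+1)`!%:R^-1 = m`!%:R^-1 :> R.
  by rewrite factS natrM invfM mulrA divff ?pnatr_eq0 // mul1r.
rewrite /binomp big_ord_recr /= -polyC_natr mul_polyC scalerA factV -scalerAr.
by rewrite [_ * \prod_(_ < _) _]mulrC.
Qed.

Lemma binompS y m : binomp (y + 1) m.+1 = binomp y m.+1 + binomp y m.
Proof.
have mS_neq0 : m.+1%:R != 0 :> {poly R}.
  by rewrite -polyC_natr polyC_eq0 pnatr_eq0.
apply: (mulfI mS_neq0); rewrite mulrDr !mul_binomp_left.
have := mul_binomp_down (y + 1) m; rewrite addrK => <-.
by rewrite -natr1; ring.
Qed.

Lemma binomp_central_diff y m :
  binomp (y + 1) m.+2 + binomp (y - 1) m.+2 =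
    2 * binomp y m.+2 + binomp (y - 1) m.
Proof.
have pascal k : binomp y k.+1 = binomp (y - 1) k.+1 + binomp (y - 1) k.
  by rewrite -binompS subrK.
by rewrite binompS (pascal m) (pascal m.+1); ring.
Qed.

Lemma divp_binomp_central y m : y != 0 ->
  (binomp y m * (2 * y - m%:R)) %/ y = binomp y m + binomp (y - 1) m.
Proof.
move=> y_neq0; rewrite -[RHS](mulKp _ y_neq0) [in RHS]mulrDr mul_binomp_down.
by congr (_ %/ _); ring.
Qed.

End BinomialPolynomial.

Section HankelColumns.
Variables (R : realType) (b : R).

Definition Hcol (j : nat) : {poly R} :=
  binomp ('X + j%:R) (2 * j)%N + b *: binomp ('X + j%:R) (2 * j + 1)%N.

Lemma poly_shift_Hcol c j :
  poly_shift c (Hcol j) =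
    binomp ('X + c%:P + j%:R) (2 * j)%N +
      b *: binomp ('X + c%:P + j%:R) (2 * j + 1)%N.
Proof.
rewrite /poly_shift /Hcol comp_polyD (comp_polyZ b) !binomp_comp.
by rewrite comp_polyD comp_polyX rmorph_nat.
Qed.

Lemma Hcol_central_diff j :
  poly_shift 1 (Hcol j) + poly_shift (-1) (Hcol j) =
    2 *: Hcol j + (if j is j'.+1 then Hcol j' else 0).
Proof.
rewrite !poly_shift_Hcol polyCN polyC1 -(mul_polyC 2) polyC_natr.
case: j => [|j]; rewrite /Hcol -!(mul_polyC b).
  by rewrite !muln0 add0n !binomp0 !binomp1 !addr0; ring.
have XDj1B1 : 'X + j.+1%:R - 1 = 'X + j%:R :> {poly R}.
  by rewrite -natr1 addrA addrK.
rewrite addrACA -mulrDr mulnS add2n !addSn.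
by rewrite ![_ + _ + j.+1%:R]addrAC !binomp_central_diff XDj1B1; ring.
Qed.

Lemma VentryE i j :
  Ventry b i j = poly_shift (i%:R - 2^-1) (half_shift_sum (Hcol j)).
Proof.
have XiDj_neq0 : 'X + i%:R + j%:R != 0 :> {poly R}.
  by rewrite -addrA -natrD -polyC_natr -size_poly_eq0 size_XaddC.
have shiftE : i%:R - 2^-1 - 2^-1 = i%:R - 1 :> R by field.
rewrite linearD /= !poly_shiftD subrK shiftE !poly_shift_Hcol addrACA.
rewrite -(scalerDr b) polyCB polyC1 polyC_natr ['X + (_ - 1)]addrA.
rewrite [_ - 1 + _]addrAC -!divp_binomp_central //.
rewrite /Ventry /Vnum_even /Vnum_odd.
congr (_ * _ %/ _ + _ *: (_ * _ %/ _)).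
  by rewrite natrM; ring.
by rewrite natrD natrM; ring.
Qed.

Lemma V_det n :
  V n b = 2 ^+ n *
    \det (\matrix_(i < n, j < n) poly_shift (i%:R - 2^-1) (Hcol j)).
Proof.
have argE : 2^-1 *: (2 * 'X - 1) = 'X - (2^-1)%:P :> {poly R}.
  rewrite scalerBr -polyC_natr mul_polyC scalerA mulVf ?pnatr_eq0 //.
  by rewrite scale1r alg_polyC.
rewrite /V /H -det_map_mx; congr (_ * \det _); apply/matrixP=> i j.
rewrite !mxE poly_shift_Hcol /= argE comp_polyD (comp_polyZ b) !binomp_comp.
rewrite !comp_polyD comp_polyX !rmorph_nat polyCB polyC_natr addrA.
by rewrite ['X + _ - _]addrAC.
Qed.

Definition half_shift_sum_sqr_mx n : 'M[R]_n :=
  4%:M + \matrix_(i < n, j < n) (i == j.+1 :> nat)%:R.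

Lemma half_shift_sum_sqr_Hcol n (i : 'I_n) :
  half_shift_sum (half_shift_sum (Hcol i)) =
    \sum_k half_shift_sum_sqr_mx n i k *: Hcol k.
Proof.
rewrite half_shift_sum_sqr Hcol_central_diff addrAC -scalerDl -natrD.
under [RHS]eq_bigr do rewrite mxE scalerDl.
rewrite big_split; congr (_ + _).
  rewrite (bigD1 i) //= mxE eqxx big1 ?addr0 // => k neik.
  by rewrite mxE eq_sym (negPf neik) scale0r.
case: i => [[|i] lti] /=; first by rewrite big1 // => k _; rewrite mxE scale0r.
rewrite (bigD1 (Ordinal (ltnW lti))) //= mxE eqxx scale1r big1 ?addr0 // => k.
by rewrite -val_eqE mxE eqSS eq_sym /= => /negPf->; rewrite scale0r.
Qed.

Lemma half_shift_sum_Hcol n :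
  exists C : 'M[R]_n, [/\ is_trig_mx C, forall i, C i i = 2 &
    forall j : 'I_n, half_shift_sum (Hcol j) = \sum_k C j k *: Hcol k].
Proof.
have [||i|C [trigC diagC sqrC]] :=
  @trig_mx_sqrt _ 2 n (half_shift_sum_sqr_mx n).
- by rewrite -natrM unitfE pnatr_eq0.
- apply/is_trig_mxP=> i j ltij; rewrite !mxE -val_eqE !ltn_eqF ?addr0 //.
  exact: ltnW.
- by rewrite !mxE eqxx ltn_eqF // addr0 -natrX.
exists C; split=> //; apply: linear_sqrt_trig => // i.
  by move=> f; apply: half_shift_sum_addZ_eq0; rewrite diagC -natrD pnatr_eq0.
by rewrite sqrC; apply: half_shift_sum_sqr_Hcol.
Qed.

End HankelColumns.

Theorem theorem9 (R : realType) (b : R) (n : nat) :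
  V n b = \det (\matrix_(i < n, j < n) Ventry b i j).
Proof.
have [C [trigC diagC half_shiftE]] := half_shift_sum_Hcol b n.
have -> : \matrix_(i < n, j < n) Ventry b i j =
    (\matrix_(i < n, j < n) poly_shift (i%:R - 2^-1) (Hcol b j)) *m
      (map_mx polyC C)^T.
  apply/matrixP=> i j; rewrite !mxE VentryE half_shiftE linear_sum.
  by apply: eq_bigr => k _; rewrite !mxE linearZ /= -mul_polyC mulrC.
have detC : \det C = 2 ^+ n.
  by rewrite det_trig // (eq_bigr _ (fun i _ => diagC i)) prodr_const card_ord.
by rewrite V_det det_mulmx det_tr det_map_mx detC rmorphXn /= polyC_natr mulrC.
Qed.
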